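(* For $n\geq 1$, the number of permutations $\pi\in\mathcal{S}_n$ such that both $\pi$ and $\theta(\pi)$ avoid $312$ equals $2^{n-1}$.
   Context: $\mathcal{S}_n$ is the symmetric group on $[n]$, permutations in one-line notation $\pi_1\cdots\pi_n$. A permutation avoids a pattern $\tau$ if it has no subsequence order-isomorphic to $\tau$. The standard cycle notation of $\pi$ writes each cycle (fixed points included) with its largest element first and orders cycles by increasing largest element. The fundamental bijection $\theta:\mathcal{S}_n\to\mathcal{S}_n$ maps $\pi$ to the permutation whose one-line notation is obtained by erasing the parentheses of the standard cycle notation of $\pi$. *)

(* Defs.v *)
From mathcomp Require Import all_boot all_fingroup.

Set Implicit Arguments.
Unset Strict Implicit.
Unset Printing Implicit Defensive.

(** The symmetric group on [n] is ['S_n], with [n] = {1, ..., n} relabelled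
    in increasing order as ['I_n] = {0, ..., n-1}. *)

Section Defs.

Variable n : nat.
Implicit Types (p : 'S_n) (m : 'I_n).

Definition one_line p : seq 'I_n := [seq p i | i <- enum 'I_n].

Definition order_iso (s t : seq nat) : bool :=
  (size s == size t) &&
  [forall i : 'I_(size s), forall j : 'I_(size s),
     (nth 0 s i < nth 0 s j) == (nth 0 t i < nth 0 t j)].

(** A pattern is given by its one-line word; only the relative order of its
    letters matters, so [:: 3; 1; 2] is the pattern 312. *)
Definition avoids (tau : seq nat) p : bool :=
  ~~ [exists s : (size tau).-tuple 'I_n,
        subseq s (one_line p) && order_iso [seq val x | x <- s] tau].

Definition cycle_max p m : bool := [forall y in porbit p m, y <= m].

(** The cycle (m, p m, p (p m), ...) of [p] through [m], written from [m]. *)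
Definition cycle_from p m : seq 'I_n := traject p m #|porbit p m|.

(** [enum 'I_n] is increasing, so the cycles are listed by increasing maximum. *)
Definition standard_cycles p : seq (seq 'I_n) :=
  [seq cycle_from p m | m <- enum 'I_n & cycle_max p m].

Definition theta_word p : seq 'I_n := flatten (standard_cycles p).

Lemma mem_cycle_from p m x : (x \in cycle_from p m) = (x \in porbit p m).
Proof. by rewrite /cycle_from -porbit_traject. Qed.

Lemma mem_theta_word p x : x \in theta_word p.
Proof.
have [m mx maxm] := arg_maxnP (fun y : 'I_n => y : nat) (porbit_id p x).
apply/flatten_mapP; exists m.
  rewrite mem_filter mem_enum andbT; apply/forall_inP => y.
  have /eqP -> : porbit p m == porbit p x by rewrite eq_porbit_mem.
  exact: maxm.
by rewrite mem_cycle_from porbit_sym.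
Qed.

Lemma uniq_theta_word p : uniq (theta_word p).
Proof.
rewrite /theta_word /standard_cycles.
have: all (cycle_max p) [seq m <- enum 'I_n | cycle_max p m].
  exact: filter_all.
have: uniq [seq m <- enum 'I_n | cycle_max p m].
  by rewrite filter_uniq // enum_uniq.
elim: [seq _ <- _ | _] => //= m s IHs /andP[mNs us] /andP[mm ms].
rewrite cat_uniq uniq_traject_porbit IHs // andbT.
apply/hasPn => x /flatten_mapP[k ks]; rewrite mem_cycle_from => xk.
apply/negP; rewrite -/(cycle_from p m) mem_cycle_from => xm.
have eq_mk : porbit p m = porbit p k.
  by move: xk xm; rewrite -!eq_porbit_mem => /eqP <- /eqP <-.
suff eq_m_k : m = k by rewrite eq_m_k ks in mNs.
apply/val_inj/eqP; rewrite eqn_leq.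
have /forall_inP maxk := allP ms _ ks; have /forall_inP maxm := mm.
by rewrite maxk ?maxm // ?eq_mk ?porbit_id // -eq_mk porbit_id.
Qed.

Lemma size_theta_word p : size (theta_word p) = n.
Proof.
rewrite -[RHS]card_ord cardE; apply/perm_size/uniq_perm => //.
- exact: uniq_theta_word.
- exact: enum_uniq.
by move=> x; rewrite mem_theta_word mem_enum.
Qed.

Lemma theta_subproof p : injective (fun i : 'I_n => nth i (theta_word p) i).
Proof.
move=> i j; rewrite (set_nth_default i j) ?size_theta_word // => /eqP.
by rewrite nth_uniq ?size_theta_word ?uniq_theta_word // => /eqP/val_inj.
Qed.

(** The permutation with one-line notation [theta_word p]; the default of
    [nth] is never reached, see [one_line_theta]. *)
Definition theta p : 'S_n := perm (@theta_subproof p).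

Lemma one_line_theta p : one_line (theta p) = theta_word p.
Proof.
have sz : size (one_line (theta p)) = n by rewrite size_map -cardE card_ord.
case: (posnP n) => [n0 | n_gt0].
  apply: etrans (size0nil _) (esym (size0nil _)); first by rewrite sz.
  by rewrite size_theta_word.
apply: (@eq_from_nth _ (Ordinal n_gt0)) => [|i]; rewrite sz ?size_theta_word //.
move=> lt_in; rewrite (nth_map (Ordinal n_gt0)) ?size_enum_ord // permE.
rewrite nth_enum_ord //; apply: set_nth_default.
by rewrite size_theta_word.
Qed.

End Defs.

(* Main.v *)
(** The cycles of [p] appear in the word of [theta p] with their maximum first,
    so if [theta p] avoids 312 every cycle is listed in decreasing order; a
    cycle of length at least three of this form creates a 312 in [p].  Hence
    [p] is an involution.  Conversely, for an involution avoiding 312, a 312 in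
    the word of [theta p] would force two crossing 2-cycles, which form a 312
    in [p].  Finally the involutions avoiding 312 are the layered permutations
    (each block of consecutive positions is reversed), and these correspond to
    their ascent sets, which are arbitrary subsets of the [n - 1] gaps. *)

Require Import Defs.
From mathcomp Require Import all_boot all_fingroup.
From mathcomp Require Import zify.

Set Implicit Arguments.
Unset Strict Implicit.
Unset Printing Implicit Defensive.

(** * The pattern 312 read off three positions *)

Section Pattern312.

Variable n : nat.
Implicit Types (p : 'S_n) (i j k x y z : 'I_n).

Lemma avoids312P p :
  reflect (forall x y z, subseq [:: x; y; z] (one_line p) -> ~ (y < z < x))
          (avoids [:: 3; 1; 2] p).
Proof.
have iso x y z : order_iso [:: val x; val y; val z] [:: 3; 1; 2] = (y < z < x).
  apply/idP/idP => [/andP[_ /forallP h]|yzx].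
    have /forallP/(_ (inord 2))/eqP := h (inord 1).
    have /forallP/(_ (inord 0))/eqP := h (inord 2).
    by rewrite !inordK //= => -> ->.
  apply/andP; split=> //; apply/forallP => -[[|[|[|//]]] /= ?];
    apply/forallP => -[[|[|[|//]]] /= ?]; apply/eqP; lia.
apply: (iffP idP) => [/existsPn av x y z xyz yzx|av].
  by have /= := av [tuple x; y; z]; rewrite xyz iso yzx.
apply/existsPn => -[[|x [|y [|z [|]]]] //= sz].
by apply/negP => /andP[/av]; rewrite iso.
Qed.

Lemma avoids312_posP p :
  reflect (forall i j k, i < j -> j < k -> ~ (p j < p k < p i))
          (avoids [:: 3; 1; 2] p).
Proof.
pose lt := relpre (@nat_of_ord n) ltn.
have lt_trans : transitive lt by move=> y x z; apply: ltn_trans.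
have srt : sorted lt (enum 'I_n).
  by rewrite -sorted_map val_enum_ord iota_ltn_sorted.
apply: (iffP (avoids312P p)) => av.
  move=> i j k ij jk; apply: av; rewrite -[[:: _; _; _]]/(map p [:: i; j; k]).
  apply: map_subseq.
  (* A strictly increasing list is determined by its members, so the triple of positions is a filter
     of [enum 'I_n]. *)
  suff -> : [:: i; j; k] = [seq x <- enum 'I_n | x \in [:: i; j; k]].
    exact: filter_subseq.
  apply: (irr_sorted_eq lt_trans) => [x|||x].
  - by rewrite /lt /= ltnn.
  - by rewrite /= /lt /= ij jk.
  - exact: sorted_filter.
  - by rewrite mem_filter mem_enum andbT.
move=> x y z /subseqP[b _]; rewrite /one_line -map_mask.
have := subseq_sorted lt_trans (mask_subseq b (enum 'I_n)) srt.
case: (mask b _) => [|i [|j [|k [|]]]] //= /and3P[ij jk _] [-> -> ->].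
exact: av.
Qed.

End Pattern312.

(** * Avoidance of 312 by [p] and [theta p] forces an involution *)

Section ThetaInvolution.

Variable n : nat.
Implicit Types (p : 'S_n) (m x y z : 'I_n).

Lemma subseq_flatten (T : eqType) (s : seq T) ss :
  s \in ss -> subseq s (flatten ss).
Proof.
elim: ss => //= t ss IH; rewrite inE => /orP[/eqP->|/IH ?].
  exact: prefix_subseq.
exact: subseq_trans (suffix_subseq _ _).
Qed.

Lemma cycle_max_exists p x : exists2 m, cycle_max p m & x \in porbit p m.
Proof.
have [m mx maxm] := arg_maxnP (fun y : 'I_n => y : nat) (porbit_id p x).
exists m; last by rewrite porbit_sym.
apply/forall_inP => y; have /eqP -> : porbit p m == porbit p x.
  by rewrite eq_porbit_mem.
exact: maxm.
Qed.

Lemma subseq_cycle_from p m : cycle_max p m ->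
  subseq (cycle_from p m) (theta_word p).
Proof.
by move=> mm; apply/subseq_flatten/map_f; rewrite mem_filter mm mem_enum.
Qed.

Lemma avoids312_theta_involutive p : avoids [:: 3; 1; 2] p ->
  avoids [:: 3; 1; 2] (theta p) -> involutive p.
Proof.
move=> /avoids312_posP avp /avoids312P; rewrite one_line_theta => avt.
(* Every point is an iterate of the maximum of its cycle, and [p] commutes with its powers. *)
suff inv_max m : cycle_max p m -> p (p m) = m.
  move=> x; have [m /inv_max pm] := cycle_max_exists p x.
  by case/porbitP => k ->; rewrite permX -2!iterS 2!iterSr pm.
move=> mm; have sub := subseq_cycle_from mm.
have /forall_inP maxm := mm.
(* As [m] is the largest entry of its cycle, [x < y] would make [m], [x], [y] a 312 in the word. *)
have decr x y : subseq [:: m; x; y] (cycle_from p m) -> y < x < m.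
  move=> xy; have := avt _ _ _ (subseq_trans xy sub).
  have /= := subseq_uniq xy (uniq_traject_porbit p m).
  have in_cyc z : z \in [:: m; x; y] -> z <= m.
    by move/(mem_subseq xy); rewrite mem_cycle_from; apply: maxm.
  have := in_cyc x; have := in_cyc y; rewrite !inE !eqxx !orbT.
  by rewrite -!val_eqE /= => /(_ isT) ? /(_ isT) ?; lia.
have := iter_porbit p m; have := card_porbit_neq0 p m.
move: decr; rewrite /cycle_from.
case: #|porbit p m| => [|[|[|k]]] decr //= _ pk; first by rewrite !pk.
(* In a cycle of length [k.+3] written from [m], the last two entries are [d] and [p d]. *)
set d := iter k.+1 p m; have cE : p (p d) = m := pk.
have dc : p d < d < m.
  apply: decr; rewrite 2!trajectSr trajectS /= eqxx -!cats1 -catA.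
  exact: suffix_subseq.
have pmc : p d < p m < m.
  apply: decr; rewrite trajectSr 2!trajectS /= !eqxx -cats1.
  exact: suffix_subseq.
(* The positions [p d < d < m] carry the values [m], [p d], [p m], which form a 312. *)
by case: (avp (p d) d m); rewrite ?cE; lia.
Qed.

(** * For involutions, avoidance of 312 passes from [p] to [theta p] *)

Section Involution.

Variable p : 'S_n.
Hypothesis invp : involutive p.

Lemma involutive_cycle_from m : cycle_from p m \in [:: [:: m]; [:: m; p m]].
Proof.
have := uniq_traject_porbit p m; have := card_porbit_neq0 p m.
rewrite /cycle_from !inE; case: #|_| => [|[|[|k]]] //= _; rewrite ?eqxx ?orbT //.
by rewrite invp !inE eqxx orbT.
Qed.

(** For an involution this is the maximum of the cycle of [x]. *)
Definition top x := maxn x (p x).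

Lemma cycle_max_le m : cycle_max p m -> p m <= m.
Proof. by move=> /forall_inP; apply; apply: (mem_porbit p 1 m). Qed.

Lemma top_cycle m x : cycle_max p m -> x \in cycle_from p m -> top x = m.
Proof.
move=> /cycle_max_le; rewrite /top.
have := involutive_cycle_from m; rewrite !inE => /orP[]/eqP->; rewrite !inE.
  by move=> ? /eqP->; lia.
by move=> ? /orP[]/eqP->; rewrite ?invp; lia.
Qed.

(** The first alternative covers entries of distinct cycles, listed by increasing maximum; the
    second covers the two entries of a 2-cycle, maximum first. *)
Lemma pairwise_theta_word :
  pairwise (fun x y => (top x < top y) || (y == p x) && (y < x)) (theta_word p).
Proof.
rewrite /theta_word /standard_cycles.
have := filter_all (cycle_max p) (enum 'I_n).
have: pairwise (relpre val ltn) [seq m <- enum 'I_n | cycle_max p m].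
  rewrite -sorted_pairwise; last by move=> ? ? ?; apply: ltn_trans.
  apply: sorted_filter; first by move=> ? ? ?; apply: ltn_trans.
  by rewrite -sorted_map val_enum_ord iota_ltn_sorted.
elim: [seq _ <- _ | _] => //= m s IHs /andP[/allP ms sr] /andP[mm sm].
rewrite pairwise_cat IHs // andbT; apply/andP; split.
  apply/allrelP => x y xm /flatten_mapP[k ks yk].
  rewrite (top_cycle mm xm) (top_cycle (allP sm _ ks) yk).
  by rewrite [_ < _]ms.
have := uniq_traject_porbit p m; rewrite -/(cycle_from p m).
have := cycle_max_le mm.
have := involutive_cycle_from m; rewrite !inE => /orP[]/eqP-> //=.
rewrite inE -val_eqE /= eqxx /=; lia.
Qed.

(** Since [top] never decreases along the word, a 312 [x], [y], [z] has [top y] and [top z] at least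
    [x]; hence [y] and [z] are the smaller elements of two distinct 2-cycles. *)
Lemma avoids312_theta : avoids [:: 3; 1; 2] p -> avoids [:: 3; 1; 2] (theta p).
Proof.
move=> /avoids312_posP avp; apply/avoids312P => x y z.
rewrite one_line_theta => /subseq_pairwise/(_ pairwise_theta_word) /=.
rewrite -!val_eqE /top /= => h yzx.
(* The 2-cycles of [y] and [z] cross: [y < z < p y < p z]. *)
have cross : z < p y < p z.
  have swap u : val u = val (p x) -> val (p u) = val x.
    by move=> /val_inj ->; rewrite invp.
  have := swap y; have := swap z; rewrite /=; lia.
(* The positions [y < p y < p z] carry the values [p y], [y], [z]. *)
by apply: (avp y (p y) (p z)); rewrite ?invp; lia.
Qed.

End Involution.

End ThetaInvolution.

(** * Reversal of the blocks between consecutive cuts *)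

Section Blocks.

Variables (m : nat) (s : pred nat).
Hypothesis s_ge : forall i, m <= i -> s i.

(** Here [s j] marks a cut between [j] and [j.+1], and position 0 always starts a block. *)
Definition block a b i :=
  [/\ a <= i <= b, forall j, a <= j < b -> ~~ s j, (a == 0) || s a.-1 & s b].

Fixpoint block_lo i :=
  if i is j.+1 then if s j then i else block_lo j else 0.

Lemma cut_ge_exists i : exists b, (i <= b) && s b.
Proof. by exists (maxn i m); rewrite leq_maxl s_ge ?leq_maxr. Qed.

Definition block_hi i := ex_minn (cut_ge_exists i).

Lemma blockP i : block (block_lo i) (block_hi i) i.
Proof.
rewrite /block_hi; case: ex_minnP => b /andP[ib sb] minb.
have ge_i j : i <= j < b -> ~~ s j.
  move=> ijb; apply/negP => sj; have := minb j; rewrite sj; lia.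
suff [lo_i lo_s lo0] : [/\ block_lo i <= i,
    forall j, block_lo i <= j < i -> ~~ s j &
    (block_lo i == 0) || s (block_lo i).-1].
  split=> //; first by rewrite lo_i.
  by move=> j jb; case: (ltnP j i) => ji; [apply: lo_s | apply: ge_i]; lia.
elim: i {b ib sb minb ge_i} => //= i [IH1 IH2 IH3].
case: ifPn => si; first by split=> // j; lia.
split=> // [|j ji]; first exact: leqW.
by have [->|ne] := eqVneq j i => //; apply: IH2; lia.
Qed.

(** If the endpoints differed, a cut bounding one block would fall inside the other. *)
Lemma block_unique a b a' b' i : block a b i -> block a' b' i ->
  a = a' /\ b = b'.
Proof.
case=> i1 n1 l1 r1 [i2 n2 l2 r2].
have := n1 a'.-1; have := n2 a.-1; have := n1 b'; have := n2 b.
rewrite r1 r2; lia.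
Qed.

Lemma block_mem a b i j : block a b i -> a <= j <= b -> block a b j.
Proof. by case=> i1 n1 l1 r1 ij; split. Qed.

Lemma block_le a b i : i <= m -> block a b i -> b <= m.
Proof. by move=> im [? n1 _ _]; have := n1 m; rewrite s_ge //; lia. Qed.

Lemma block_disjoint a b i a' b' i' : block a b i -> block a' b' i' ->
  i < i' -> (a = a' /\ b = b') \/ b < a'.
Proof.
move=> B B' ii'; case: (ltnP b a') => ba; [by right | left].
have [? _ _ _] := B; have [? _ _ _] := B'.
(* Once the intervals overlap, the larger left end lies in both. *)
have ca : maxn a a' <= b /\ maxn a a' <= b' by lia.
apply: (@block_unique _ _ _ _ (maxn a a')).
  by apply: block_mem B _; lia.
by apply: block_mem B' _; lia.
Qed.

Definition block_rev i := block_lo i + block_hi i - i.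

Lemma block_revE a b i : block a b i -> block_rev i = a + b - i.
Proof. by move=> /(block_unique (blockP i))[<- <-]. Qed.

Lemma block_rev_le i : i <= m -> block_rev i <= m.
Proof.
move=> im; have B := blockP i; have := block_le im B; case: B => ? _ _ _.
rewrite /block_rev; lia.
Qed.

Lemma block_revK : involutive block_rev.
Proof.
move=> i; have B := blockP i; have [ib _ _ _] := B.
rewrite (@block_revE (block_lo i) (block_hi i) (block_rev i)).
  by rewrite /block_rev; lia.
by apply: block_mem B _; rewrite /block_rev; lia.
Qed.

Lemma block_rev_ascent i : (block_rev i < block_rev i.+1) = s i.
Proof.
have B := blockP i; have B' := blockP i.+1.
have [ib ni _ ri] := B; have [ib' ni' li' _] := B'.
have := ni i; have := ni' i.
have [[ea eb]|lt] := block_disjoint B B' (ltnSn i).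
  by rewrite /block_rev -ea -eb in ib' *; case: (s i); lia.
have e : block_lo i.+1 = i.+1 by lia.
by rewrite e /= in li' *; rewrite li' /block_rev e; lia.
Qed.

(** Values decrease within a block and increase from block to block. An increase from [j] to [k]
    puts [k] in a later block than [j], hence later than [i], so its value exceeds that of [i]. *)
Lemma block_rev_avoids i j k : i < j -> j < k ->
  ~ (block_rev j < block_rev k < block_rev i).
Proof.
move=> ij jk; have Bi := blockP i; have Bj := blockP j; have Bk := blockP k.
have := block_disjoint Bi Bj ij; have := block_disjoint Bj Bk jk.
have := block_disjoint Bi Bk (ltn_trans ij jk).
case: Bi Bj Bk => [? _ _ _] [? _ _ _] [? _ _ _]; rewrite /block_rev; lia.
Qed.

End Blocks.

(** * Involutions avoiding 312 are block reversals *)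

Section Layered.

Variables (m : nat) (f : nat -> nat) (s : pred nat).
Hypothesis f_le : forall i, i <= m -> f i <= m.
Hypothesis fK : forall i, i <= m -> f (f i) = i.
Hypothesis f312 : forall i j k, i < j -> j < k -> k <= m -> ~ (f j < f k < f i).
Hypothesis s_ge : forall i, m <= i -> s i.
Hypothesis sE : forall i, i < m -> s i = (f i < f i.+1).

(** The pattern 231 is the inverse of 312, and [f] is its own inverse. *)
Lemma avoids312_involution_231 i j k : i < j -> j < k -> k <= m ->
  ~ (f k < f i < f j).
Proof.
move=> ij jk km /andP[ki ij']; apply: (f312 ki ij'); first by apply: f_le; lia.
by rewrite !fK; lia.
Qed.

(** Avoiding 231 at [b], [b.+1], [j] gives [f b < f j]; then [f j < f i] would make [i], [b], [j] a
    312. *)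
Lemma ascent_split b i j : s b -> i <= b -> b < j -> j <= m -> f i < f j.
Proof.
move=> sb ib bj jm; have := sb; rewrite sE; last lia.
have fI k l : k <= m -> l <= m -> f k = f l -> k = l.
  by move=> km lm e; rewrite -(fK km) e fK.
have c1 : i = b \/ i < b by lia.
have c2 : j = b.+1 \/ b.+1 < j by lia.
have := fI i j; have := fI i b.+1; have := fI b j.
have := @f312 i b b.+1; have := @avoids312_involution_231 b b.+1 j.
have := @f312 i b j; case: c1 => [->|?]; case: c2 => [->|?]; lia.
Qed.

(** If [f] moved [i] upwards across [b], splitting at [b] would give [f i < f (f i) = i], which is
    absurd; likewise downwards. *)
Lemma ascent_stable b i : s b -> i <= m -> (f i <= b) = (i <= b).
Proof.
move=> sb im; have := @ascent_split b i (f i) sb.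
have := @ascent_split b (f i) i sb; rewrite fK // f_le //; lia.
Qed.

Lemma layeredE i : i <= m -> f i = block_rev s_ge i.
Proof.
move=> im; have B := blockP s_ge i; have bm := block_le s_ge im B.
rewrite /block_rev; set a := block_lo s i in B *.
set b := block_hi s_ge i in B bm *; case: B => iab nab sa sb.
have stab j : a <= j <= b -> a <= f j <= b.
  move=> jab; rewrite (ascent_stable sb) //; last lia.
  have := @ascent_stable a.-1 j; case: eqP sa => [->|] /=; first by lia.
  by move=> a0 -> /(_ isT); lia.
have decr j : a <= j < b -> f j.+1 < f j.
  move=> jab; have := nab j jab; rewrite sE; last lia.
  have := fK (i := j); have := fK (i := j.+1).
  by case: (ltngtP (f j) (f j.+1)) => // ->; lia.
(* A strictly decreasing self-map of the interval from [a] to [b] is its reversal: descending from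
   [a] bounds [f] above, climbing back from [b] bounds it below. *)
have up k : a + k <= b -> f (a + k) + k <= b.
  elim: k => [|k IH] kb; first by have := stab (a + 0); lia.
  have lt : f (a + k).+1 < f (a + k) by apply: decr; lia.
  by rewrite (addnS a); have := IH; lia.
have down k : a + k <= b -> a + k <= f (b - k).
  elim: k => [|k IH] kb; first by have := stab (b - 0); lia.
  have := decr (b - k.+1); have -> : (b - k.+1).+1 = b - k by lia.
  move=> lt; apply: leq_trans (lt _); last lia.
  by have := IH; lia.
have := up (i - a); have := down (b - i).
have -> : b - (b - i) = i by lia.
by rewrite subnKC; lia.
Qed.

End Layered.

(** * Counting by ascent sets *)

Section Ascents.

Variable m : nat.
Implicit Types (p : 'S_m.+1) (A : {set 'I_m}).

Definition ascents p : {set 'I_m} := [set i : 'I_m | p (inord i) < p (inord i.+1)].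

(** The value [true] outside ['I_m] closes the last block at [m]. *)
Definition cut A j := if insub j is Some i then i \in A else true.

Lemma cut_ge A j : m <= j -> cut A j.
Proof. by move=> mj; rewrite /cut insubF // ltnNge mj. Qed.

Lemma layered_permE p : involutive p -> avoids [:: 3; 1; 2] p ->
  forall i, p i = block_rev (@cut_ge (ascents p)) i :> nat.
Proof.
move=> invp /avoids312_posP avp i.
rewrite -(@layeredE m (fun j => p (inord j))) ?inord_val //.
- by move=> j _; rewrite -ltnS.
- by move=> j jm; rewrite inord_val invp inordK.
- by move=> j k l jk kl lm; apply: avp; rewrite !inordK //; lia.
- by move=> j jm; rewrite /cut insubT inE.
- by rewrite -ltnS.
Qed.

Lemma ascents_surj A :
  exists2 p : 'S_m.+1, involutive p /\ avoids [:: 3; 1; 2] p & ascents p = A.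
Proof.
pose g (i : 'I_m.+1) : 'I_m.+1 := inord (block_rev (@cut_ge A) i).
have gE i : g i = block_rev (@cut_ge A) i :> nat.
  by rewrite inordK // ltnS; apply: block_rev_le; rewrite -ltnS.
have gK : involutive g by move=> i; apply: val_inj; rewrite /= !gE block_revK.
exists (perm (inv_inj gK)); first split.
- by move=> i; rewrite !permE gK.
- apply/avoids312_posP => i j k ij jk; rewrite !permE !gE.
  exact: block_rev_avoids.
apply/setP => i; rewrite inE !permE !gE !inordK; last 2 first.
- by rewrite ltnS.
- by rewrite ltnS ltnW.
by rewrite block_rev_ascent /cut valK.
Qed.

(** [ascents] is a bijection onto all subsets of the [m] gaps: the block reversal recovers [p] from
    its ascents, and every subset occurs. *)
Lemma card_involutive_avoids312 (E : {set 'S_m.+1}) :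
  (forall p : 'S_m.+1, reflect (involutive p /\ avoids [:: 3; 1; 2] p) (p \in E)) ->
  #|E| = 2 ^ m.
Proof.
move=> EP; have injE : {in E &, injective ascents}.
  move=> p q /EP[ip ap] /EP[iq aq] e; apply/permP => i; apply: val_inj.
  by rewrite /= (layered_permE ip ap) (layered_permE iq aq) e.
rewrite -(card_in_imset injE); have -> : ascents @: E = powerset [set: 'I_m].
  apply/setP => A; rewrite powersetE subsetT; have [p pE <-] := ascents_surj A.
  by apply/imset_f/EP.
by rewrite card_powerset cardsT card_ord.
Qed.

End Ascents.

Theorem theorem3p9 (n : nat) (hn : 1 <= n) :
  #|[set p : 'S_n | avoids [:: 3; 1; 2] p && avoids [:: 3; 1; 2] (theta p)]|
  = 2 ^ (n - 1).
Proof.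
case: n hn => // m _; rewrite subn1; apply: card_involutive_avoids312 => p.
rewrite inE; apply: (iffP andP) => [[ap at_]|[ip ap]]; split=> //.
  exact: avoids312_theta_involutive.
exact: avoids312_theta.
Qed.
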